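(* Let $(U,\mu)$ be a fuzzy Hilbert space (satisfying the standing assumptions in the context), let $K$ be a strongly fuzzy bounded linear operator on $U$, let $\{f_i\}_{i=1}^\infty$ be a fuzzy $K$-frame for $U$ with bounds $A$ and $B$, and let $\{g_i\}_{i=1}^\infty$ be a sequence in $U$. If there exists a constant $M>1$ such that $$\sum_{i=1}^\infty|\langle f,f_i-g_i\rangle_\alpha|^2\le M\min\Big\{\sum_{i=1}^\infty|\langle f,f_i\rangle_\alpha|^2,\ \sum_{i=1}^\infty|\langle f,g_i\rangle_\alpha|^2\Big\}$$ for all $f\in U$ and all $\alpha\in(0,1)$, then $\{g_i\}_{i=1}^\infty$ is a fuzzy $K$-frame for $U$.
   Context: Let $U$ be a complex vector space with zero vector $\theta$. A fuzzy inner product on $U$ is a map $\mu:U\times U\times\mathbb C\to[0,1]$ such that for all $x,y,z\in U$, $s,t\in\mathbb C$: (FIP1) $\mu(x+y,z,|t|+|s|)\ge\min\{\mu(x,z,|t|),\mu(y,z,|s|)\}$; (FIP2) $\mu(x,y,|st|)\ge\min\{\mu(x,x,|s|^2),\mu(y,y,|t|^2)\}$; (FIP3) $\mu(x,y,t)=\mu(y,x,\overline t)$; (FIP4) $\mu(cx,y,t)=\mu(x,y,t/|c|)$ for $c\in\mathbb C\setminus\{0\}$; (FIP5) $\mu(x,x,t)=0$ for $t\in\mathbb C\setminus\mathbb R^+$; (FIP6) $\mu(x,x,t)=1$ for all $t>0$ iff $x=\theta$; (FIP7) $\mu(x,x,\cdot):\mathbb R\to[0,1]$ is non-decreasing with limit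 $1$ at $+\infty$. Put $N(x,t)=\mu(x,x,t^2)$ for $t>0$ and $N(x,t)=0$ for real $t\le0$. Standing assumptions: (FIP8) if $\mu(x,x,t^2)>0$ for all $t>0$ then $x=\theta$; (FIP9) the norms $\|x\|_\alpha=\inf\{t>0:N(x,t)\ge\alpha\}$, $\alpha\in(0,1)$ (the $\alpha$-norms, an ascending family of norms on $U$), satisfy the parallelogram law. Let $\langle\cdot,\cdot\rangle_\alpha$ be the inner product obtained from $\|\cdot\|_\alpha$ by polarization. $(U,\mu)$ is a fuzzy Hilbert space if $U$ is complete with respect to $\|\cdot\|_\alpha$ for every $\alpha\in(0,1)$. A linear operator $T$ on $U$ is strongly fuzzy bounded if there is $M>0$ with $N(Tx,s)\ge N(x,s/M)$ for all $x\in U,s\in\mathbb R$ (equivalently $\|Tx\|_\alpha\le M\|x\|_\alpha$ for all $x$ and all $\alpha\in(0,1)$, for some $M>0$). Every strongly fuzzy bounded linear operator $T$ on $U$ under consideration is taken to possess an adjoint $T^*$: a strongly fuzzy bounded linear operator on $U$ with $\langle x,Ty\rangle_\alpha=\langle T^*x,y\rangle_\alpha$ for all $x,y\in U$ and all $\alpha\in(0,1)$. For a strongly fuzzy bounded linear operator $K$ on $U$, a sequence $\{f_i\}_{i=1}^\infty$ in $U$ is a fuzzy $K$-frame for $U$ (with bounds $A,B$) if there are constants $0<A\le B<\infty$ with $A\|K^*f\|_\alpha^2\le\sum_{i=1}^\infty|\langle f,f_i\rangle_\alpha|^2\le B\|f\|_\alpha^2$ for all $f\in U$ and all $\alpha\in(0,1)$.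 Sums of nonnegative terms are valued in $[0,\infty]$. *)

(* Defs.v *)
From HB Require Import structures.
From mathcomp Require Import all_boot all_order all_algebra.
From mathcomp Require Import complex.
From mathcomp Require Import all_classical all_reals all_analysis.

Set Implicit Arguments.
Unset Strict Implicit.
Unset Printing Implicit Defensive.

Import Order.TTheory GRing.Theory Num.Theory.
Import numFieldNormedType.Exports.

Local Open Scope classical_set_scope.
Local Open Scope ring_scope.
Local Open Scope complex_scope.

Section FuzzyInnerProduct.
Context {R : realType} {U : lmodType R[i]}.

(* On R[i] the norm `|t| is valued in R[i], and [0 < t] says that t is real and
   strictly positive: [~~ (0 < t)] in FIP5 is t \in C \ R^+. *)
Record fuzzy_inner_product (mu : U -> U -> R[i] -> R) : Prop := {
  fip_range : forall x y t, 0 <= mu x y t <= 1;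
  FIP1 : forall x y z (s t : R[i]),
    mu (x + y) z (`|t| + `|s|) >= Num.min (mu x z `|t|) (mu y z `|s|);
  FIP2 : forall x y (s t : R[i]),
    mu x y `|s * t| >= Num.min (mu x x (`|s| ^+ 2)) (mu y y (`|t| ^+ 2));
  FIP3 : forall x y (t : R[i]), mu x y t = mu y x (conjc t);
  FIP4 : forall (x y : U) (c t : R[i]), c != 0 -> mu (c *: x) y t = mu x y (t / `|c|);
  FIP5 : forall x (t : R[i]), ~~ (0 < t) -> mu x x t = 0;
  FIP6 : forall x, (forall t : R, 0 < t -> mu x x t%:C = 1) <-> x = 0;
  FIP7_nondecreasing : forall x, {homo (fun t : R => mu x x t%:C) : s t / s <= t};
  FIP7_limit : forall x, mu x x t%:C @[t --> +oo] --> (1 : R)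
}.

Variable mu : U -> U -> R[i] -> R.

Definition fuzzy_norm (x : U) (t : R) : R :=
  if 0 < t then mu x x (t ^+ 2)%:C else 0.

Definition alpha_norm (alpha : R) (x : U) : R :=
  inf [set t : R | 0 < t /\ alpha <= fuzzy_norm x t].

(* Polarization identity, with the inner product linear in its first
   argument. *)
Definition alpha_inner (alpha : R) (x y : U) : R[i] :=
  ((alpha_norm alpha (x + y) ^+ 2 - alpha_norm alpha (x - y) ^+ 2) / 4) +i*
  ((alpha_norm alpha (x + 'i%C *: y) ^+ 2
    - alpha_norm alpha (x - 'i%C *: y) ^+ 2) / 4).

Definition FIP8 : Prop :=
  forall x, (forall t : R, 0 < t -> 0 < mu x x (t ^+ 2)%:C) -> x = 0.

Definition FIP9 : Prop :=
  forall alpha, 0 < alpha < 1 -> forall x y,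
    alpha_norm alpha (x + y) ^+ 2 + alpha_norm alpha (x - y) ^+ 2 =
    2 * (alpha_norm alpha x ^+ 2 + alpha_norm alpha y ^+ 2).

Definition alpha_complete (alpha : R) : Prop :=
  forall u : nat -> U,
    (forall e : R, 0 < e -> exists n0 : nat, forall m n : nat,
       (n0 <= m)%N -> (n0 <= n)%N -> alpha_norm alpha (u m - u n) < e) ->
    exists l : U, alpha_norm alpha (u n - l) @[n --> \oo] --> (0 : R).

Record fuzzy_Hilbert : Prop := {
  fuzzy_Hilbert_ip : fuzzy_inner_product mu;
  fuzzy_Hilbert_FIP8 : FIP8;
  fuzzy_Hilbert_FIP9 : FIP9;
  fuzzy_Hilbert_complete : forall alpha, 0 < alpha < 1 -> alpha_complete alpha
}.

Definition strongly_fuzzy_bounded (T : {linear U -> U}) : Prop :=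
  exists M : R, 0 < M /\
    forall (x : U) (s : R), fuzzy_norm (T x) s >= fuzzy_norm x (s / M).

Definition fuzzy_adjoint (T Tadj : {linear U -> U}) : Prop :=
  strongly_fuzzy_bounded Tadj /\
  forall alpha, 0 < alpha < 1 -> forall x y,
    alpha_inner alpha x (T y) = alpha_inner alpha (Tadj x) y.

(* \sum_i |<f, h_i>_alpha|^2, valued in [0, +oo]; sequences are indexed from 0,
   and [Normc.normc] is the modulus valued in R. *)
Definition frame_sum (alpha : R) (f : U) (h : nat -> U) : \bar R :=
  (\sum_(0 <= i <oo) (Normc.normc (alpha_inner alpha f (h i)) ^+ 2)%:E)%E.

(* [Kadj] stands for the adjoint K^* of K. *)
Definition fuzzy_K_frame_bounds (Kadj : {linear U -> U}) (f_ : nat -> U)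
    (A B : R) : Prop :=
  [/\ 0 < A, A <= B &
    forall (f : U) (alpha : R), 0 < alpha < 1 ->
      ((A * alpha_norm alpha (Kadj f) ^+ 2)%:E <= frame_sum alpha f f_)%E /\
      (frame_sum alpha f f_ <= (B * alpha_norm alpha f ^+ 2)%:E)%E].

Definition fuzzy_K_frame (Kadj : {linear U -> U}) (f_ : nat -> U) : Prop :=
  exists A B : R, fuzzy_K_frame_bounds Kadj f_ A B.

End FuzzyInnerProduct.

(* Main.v *)
(** The [alpha]-inner product, defined by polarization, is additive in its
    second argument because of the parallelogram law, so the coefficients of
    [f_ - g_] are differences of those of [f_] and [g_].  With
    [|u + v|^2 <= 2 |u|^2 + 2 |v|^2], the hypothesis makes the frame sums of
    [f_] and [g_] comparable up to the factor [2 (1 + M)] both ways, uniformly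
    in [alpha], and the frame bounds transfer. *)
Require Import Defs.
From mathcomp Require Import all_boot all_order all_algebra.
From mathcomp Require Import complex.
From mathcomp Require Import all_classical all_reals all_analysis.
From mathcomp Require Import lra.
Import Order.TTheory GRing.Theory Num.Theory.
Import numFieldNormedType.Exports.
Local Open Scope ring_scope.

(** Apply the parallelogram law to [(x + y, z)], [(x - y, z)], [(x + z, y)], [(x - z, y)] and
    combine with signs +, -, +, -: [q y], [q z], [q (x + y - z)] and [q (x - y + z)] cancel, leaving
    twice the claim. *)
Lemma polarization_additive (R : realFieldType) (V : zmodType) (q : V -> R)
    (q_parallelogram : forall x y, q (x + y) + q (x - y) = 2 * (q x + q y))
    (x y z : V) :
  q (x + (y + z)) - q (x - (y + z)) =
  (q (x + y) - q (x - y)) + (q (x + z) - q (x - z)).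
Proof.
have yp := q_parallelogram (x + y) z; have ym := q_parallelogram (x - y) z.
have zp := q_parallelogram (x + z) y; have zm := q_parallelogram (x - z) y.
rewrite (addrAC x z y) (addrAC x z (- y)) in zp.
rewrite (addrAC x (- z) y) (addrAC x (- z) (- y)) in zm.
rewrite opprD !addrA; lra.
Qed.

Lemma normc_sqr (R : rcfType) (z : R[i]) :
  Normc.normc z ^+ 2 = complex.Re z ^+ 2 + complex.Im z ^+ 2.
Proof. by case: z => a b /=; rewrite sqr_sqrtr // addr_ge0 ?sqr_ge0. Qed.

(** The right side exceeds the left by |u - v|^2. *)
Lemma normcD_sqr_le (R : rcfType) (u v : R[i]) :
  Normc.normc (u + v) ^+ 2 <= 2 * (Normc.normc u ^+ 2 + Normc.normc v ^+ 2).
Proof.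
rewrite !normc_sqr; case: u v => [a b] [c d] /=.
have := sqr_ge0 (a - c); have := sqr_ge0 (b - d); nra.
Qed.

Lemma normcB_sqr_le (R : rcfType) (u v : R[i]) :
  Normc.normc (u - v) ^+ 2 <= 2 * (Normc.normc u ^+ 2 + Normc.normc v ^+ 2).
Proof.
apply: (le_trans (normcD_sqr_le _ _ _)).
by rewrite (normc_sqr _ (- v)) (normc_sqr _ v); case: v => c d /=; rewrite !sqrrN.
Qed.

Section FrameSum.
Variables (R : realType) (U : lmodType R[i]) (mu : U -> U -> R[i] -> R).
Implicit Types (alpha : R) (f x y z : U) (h k l : nat -> U).

(** Real and imaginary parts both polarize the squared alpha-norm, at [y] and at ['i%C *: y]. *)
Lemma alpha_innerDr alpha x y z : FIP9 mu -> 0 < alpha < 1 ->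
  alpha_inner mu alpha x (y + z) =
  alpha_inner mu alpha x y + alpha_inner mu alpha x z.
Proof.
move=> H9 /H9 parallelogram; rewrite /alpha_inner scalerDr.
rewrite !(polarization_additive R U (fun v => alpha_norm mu alpha v ^+ 2)) //.
by rewrite !(mulrDl _ _ 4^-1).
Qed.

Lemma frame_sum_ge0 alpha f h : (0 <= frame_sum mu alpha f h)%E.
Proof. by apply: nneseries_ge0 => i _ _; rewrite lee_fin sqr_ge0. Qed.

Lemma frame_sum_le alpha f h k l :
  (forall i, Normc.normc (alpha_inner mu alpha f (h i)) ^+ 2 <=
     2 * (Normc.normc (alpha_inner mu alpha f (k i)) ^+ 2 +
          Normc.normc (alpha_inner mu alpha f (l i)) ^+ 2)) ->
  (frame_sum mu alpha f h <=
     2%:E * (frame_sum mu alpha f k + frame_sum mu alpha f l))%E.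
Proof.
(* The terms are nonnegative, so the series add and scale in [0, +oo] without any convergence
   argument. *)
move=> hkl; rewrite /frame_sum -nneseriesD; last 2 first.
- by move=> i _ _; rewrite lee_fin sqr_ge0.
- by move=> i _ _; rewrite lee_fin sqr_ge0.
rewrite -nneseriesZl; last first.
  by move=> i _; rewrite -EFinD lee_fin addr_ge0 ?sqr_ge0.
apply: lee_nneseries => i _; first by rewrite lee_fin sqr_ge0.
by rewrite -EFinD -EFinM lee_fin.
Qed.

End FrameSum.

Theorem theorem5p4 (R : realType) (U : lmodType R[i])
    (mu : U -> U -> R[i] -> R) (HU : fuzzy_Hilbert mu)
    (K Kadj : {linear U -> U})
    (HK : strongly_fuzzy_bounded mu K) (HKadj : fuzzy_adjoint mu K Kadj)
    (f_ g_ : nat -> U) (A B : R)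
    (Hf : fuzzy_K_frame_bounds mu Kadj f_ A B)
    (HM : exists M : R, 1 < M /\
      forall (f : U) (alpha : R), 0 < alpha < 1 ->
        (frame_sum mu alpha f (fun i => (f_ i - g_ i)%R) <=
         M%:E * Order.min (frame_sum mu alpha f f_)
                          (frame_sum mu alpha f g_))%E) :
  fuzzy_K_frame mu Kadj g_.
Proof.
have [M [M_gt1 fg_le]] := HM; have [A_gt0 A_leB f_bounds] := Hf.
have H9 := fuzzy_Hilbert_FIP9 HU.
pose C : R := 2 * (1 + M).
have C_gt1 : 1 < C by rewrite /C; lra.
have C_gt0 : 0 < C by lra.
have M_ge0 : (0 <= M%:E)%E by rewrite lee_fin; lra.
have inner_split alpha f i : 0 < alpha < 1 ->
    alpha_inner mu alpha f (f_ i) =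
    alpha_inner mu alpha f (f_ i - g_ i) + alpha_inner mu alpha f (g_ i).
  by move=> alpha01; rewrite -alpha_innerDr // subrK.
(* [S] and [T] stand for the frame sums of the two sequences, in either order: T <= 2 (D + S) <= 2
   (M S + S) = C S, where D is the frame sum of the difference. *)
have comparison alpha f (S T : \bar R) : (0 <= S)%E ->
    (T <= 2%:E * (frame_sum mu alpha f (fun i => (f_ i - g_ i)%R) + S))%E ->
    (frame_sum mu alpha f (fun i => (f_ i - g_ i)%R) <= M%:E * S)%E ->
    (T <= C%:E * S)%E.
  move=> S_ge0 T_le fg_leS; apply: (le_trans T_le).
  rewrite /C EFinM -muleA lee_pmul2l // EFinD ge0_muleDl //.
  by rewrite mul1e addeC leeD2l.
have f_le_g alpha f : 0 < alpha < 1 ->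
    (frame_sum mu alpha f f_ <= C%:E * frame_sum mu alpha f g_)%E.
  move=> alpha01; apply: comparison; first exact: frame_sum_ge0.
    apply: frame_sum_le => i; rewrite (inner_split alpha f i alpha01).
    exact: normcD_sqr_le.
  apply: (le_trans (fg_le f alpha alpha01)).
  by rewrite lee_wpmul2l // ge_min lexx orbT.
have g_le_f alpha f : 0 < alpha < 1 ->
    (frame_sum mu alpha f g_ <= C%:E * frame_sum mu alpha f f_)%E.
  move=> alpha01; apply: comparison; first exact: frame_sum_ge0.
    apply: frame_sum_le => i; rewrite addrC.
    (* For this direction, [g_ i] is [f_ i] minus the difference, hence the subtractive bound. *)
    have -> : alpha_inner mu alpha f (g_ i) =
        alpha_inner mu alpha f (f_ i) - alpha_inner mu alpha f (f_ i - g_ i).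
      by rewrite (inner_split alpha f i alpha01) addrC addKr.
    exact: normcB_sqr_le.
  apply: (le_trans (fg_le f alpha alpha01)).
  by rewrite lee_wpmul2l // ge_min lexx.
(* [f_le_g] costs a factor [C] in the lower bound, [g_le_f] one in the upper bound. *)
exists (A / C), (C * B); split; first exact: divr_gt0.
  rewrite ler_pdivrMr //.
  (* A / C <= C B amounts to A <= B C^2, which follows from A <= B and C > 1. *)
  have : 0 <= B * (C * C - 1) by rewrite mulr_ge0; nra.
  nra.
move=> f alpha alpha01; have [lower upper] := f_bounds f alpha alpha01; split.
  rewrite mulrAC mulrC EFinM lee_pdivrMl //.
  exact: le_trans lower (f_le_g alpha f alpha01).
apply: (le_trans (g_le_f alpha f alpha01)).
by rewrite -mulrA [in leRHS]EFinM lee_pmul2l.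
Qed.
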